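(* Let $N,d\ge1$, $\lambda_1,\lambda_2>0$, let $\mathbf{A}_1,\dots,\mathbf{A}_N\in\mathbb{R}^{d\times d}$ be symmetric positive semidefinite, $b_1,\dots,b_N\in\mathbb{R}^d$, and let $\mathbf{W}\in\mathbb{R}^{N\times N}$ be symmetric with non-negative entries and zero diagonal. Put $D_i=\sum_{j=1}^N\mathbf{W}_{ij}$ and $\mathbf{B}_i=\mathbf{A}_i+(2\lambda_1+4\lambda_2D_i)\mathbf{I}$. Let $\mathbf{\Theta}^*=(\theta_1^*,\dots,\theta_N^* )$, $\theta_i^*\in\mathbb{R}^d$, be the solution of the linear system $$\mathbf{A}_i\theta_i-b_i=-2\lambda_1\theta_i-2\lambda_2\sum_{j=1}^N(\mathbf{W}_{ij}+\mathbf{W}_{ji})(\theta_i-\theta_j),\qquad 1\le i\le N .$$ Given an initialization $\mathbf{\Theta}^0=(\theta_1^0,\dots,\theta_N^0)$, define $\mathbf{\Theta}^k=(\theta_1^k,\dots,\theta_N^k)$ for $k\ge1$ by $$\theta_i^k=\mathbf{B}_i^{-1}\Big(b_i+4\lambda_2\sum_{j=1}^N\mathbf{W}_{ij}\theta_j^{k-1}\Big),\qquad 1\le i\le N .$$ Then the number $k$ of iterations needed to achieve $\|\mathbf{\Theta}^k-\mathbf{\Theta}^*\|_F^2\le\epsilon$ is $\mathcal{O}(\log(1/\epsilon))$ as $\epsilon\to0^+$.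
   Context: This is the decentralized ''lifelong model update'' iteration among $N$ agents at a fixed time. $\theta_i$ is the model parameter of agent $i$; the convex local loss of agent $i$ has (second-order Taylor-approximated) gradient $\mathbf{A}_i\theta_i-b_i$; $\mathbf{W}$ is the adjacency matrix of the collaboration graph; $\lambda_1,\lambda_2$ are regularization weights. The linear system is the first-order optimality condition of the graph-regularized learning problem over $\mathbf{\Theta}$. $\|\cdot\|_F$ is the Frobenius norm of the $d\times N$ matrix with columns $\theta_i$. The constant implied in $\mathcal{O}$ may depend on everything except $\epsilon$. *)

(* Defs.v *)
From HB Require Import structures.
From mathcomp Require Import all_boot all_order all_algebra.
From mathcomp Require Import all_classical all_reals all_analysis.
Set Implicit Arguments.
Unset Strict Implicit.
Unset Printing Implicit Defensive.
Import Order.TTheory GRing.Theory Num.Theory.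
Import numFieldNormedType.Exports.
Local Open Scope ring_scope.

(* MathComp-Analysis. A family (theta_1, ..., theta_N) of vectors of R^d is the
   d x N matrix Theta with columns col i Theta. *)

Definition psdmx (R : realType) (d : nat) (A : 'M[R]_d) : Prop :=
  A \is symmetricmx /\ forall v : 'cV[R]_d, 0 <= (v^T *m A *m v) 0 0.

(* The norm `|M| that MathComp-Analysis puts on matrices is the max norm. *)
Definition frobenius_norm (R : realType) (m n : nat) (M : 'M[R]_(m, n)) : R :=
  Num.sqrt (\sum_(i < m) \sum_(j < n) M i j ^+ 2).

Definition degree (R : realType) (N : nat) (W : 'M[R]_N) (i : 'I_N) : R :=
  \sum_(j < N) W i j.

Definition Bmx (R : realType) (N d : nat) (lambda1 lambda2 : R)
    (A : 'I_N -> 'M[R]_d) (W : 'M[R]_N) (i : 'I_N) : 'M[R]_d :=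
  A i + (2 * lambda1 + 4 * lambda2 * degree W i)%:M.

Definition optimality_system (R : realType) (N d : nat) (lambda1 lambda2 : R)
    (A : 'I_N -> 'M[R]_d) (b : 'I_N -> 'cV[R]_d) (W : 'M[R]_N)
    (Theta : 'M[R]_(d, N)) : Prop :=
  forall i : 'I_N,
    A i *m col i Theta - b i =
      - ((2 * lambda1) *: col i Theta)
      - (2 * lambda2) *:
          \sum_(j < N) (W i j + W j i) *: (col i Theta - col j Theta).

(* When every A i is positive semidefinite, W has non-negative entries,
   lambda1 > 0 and lambda2 > 0, each Bmx i is positive definite, so that invmx
   is the genuine inverse. *)
Definition update (R : realType) (N d : nat) (lambda1 lambda2 : R)
    (A : 'I_N -> 'M[R]_d) (b : 'I_N -> 'cV[R]_d) (W : 'M[R]_N)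
    (Theta : 'M[R]_(d, N)) : 'M[R]_(d, N) :=
  \matrix_(l < d, i < N)
    (invmx (Bmx lambda1 lambda2 A W i) *m
       (b i + (4 * lambda2) *: \sum_(j < N) W i j *: col j Theta)) l 0.

Definition iterate (R : realType) (N d : nat) (lambda1 lambda2 : R)
    (A : 'I_N -> 'M[R]_d) (b : 'I_N -> 'cV[R]_d) (W : 'M[R]_N)
    (Theta0 : 'M[R]_(d, N)) (k : nat) : 'M[R]_(d, N) :=
  iter k (update lambda1 lambda2 A b W) Theta0.

(* K is the least number of iterations after which the error err stays at most
   eps. As err need not be monotone, K may exceed the first k such that
   err k <= eps; any upper bound on K is also an upper bound on that k. *)
Definition iterations_needed (R : realType) (err : nat -> R) (eps : R)
    (K : nat) : Prop :=
  (forall k : nat, (K <= k)%N -> err k <= eps) /\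
  (forall K' : nat, (forall k : nat, (K' <= k)%N -> err k <= eps) ->
     (K <= K')%N).

(* Main.v *)
Require Import Defs.
From HB Require Import structures.
From mathcomp Require Import all_boot all_order all_algebra.
From mathcomp Require Import all_classical all_reals all_analysis.
From mathcomp Require Import ring lra.
Set Implicit Arguments.
Unset Strict Implicit.
Unset Printing Implicit Defensive.
Import Order.TTheory GRing.Theory Num.Theory.
Import numFieldNormedType.Exports.
Local Open Scope classical_set_scope.
Local Open Scope ring_scope.

(** The columns e_i^k of the error Theta^k - Theta_star satisfy
    B_i e_i^{k+1} = 4 lambda2 sum_j W_ij e_j^k. Pairing with e_i^{k+1}, using
    A_i >= 0 on the left and 2 <x, y> <= |x|^2 + |y|^2 on the right, gives
    (lambda1 + lambda2 D_i) |e_i^{k+1}|^2 <= lambda2 sum_j W_ij |e_j^k|^2.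
    Summing over i, symmetry of W shows that the weighted energy
    sum_i (lambda1 + lambda2 D_i) |e_i|^2 contracts by a fixed factor < 1 at
    each step. This yields geometric convergence; it also makes the linear
    stationarity map injective, hence bijective, so that Theta_star exists and
    is unique. *)

(** * From a geometric error bound to a logarithmic iteration count *)

Section LinearConvergence.
Variable R : realType.
Implicit Types (err : nat -> R) (C rho eps : R).

Lemma iterations_needed_exists err eps :
  (exists n, forall k, (n <= k)%N -> err k <= eps) ->
  exists K, iterations_needed err eps K.
Proof.
move=> ex_n.
have ex_n' : exists n, `[< forall k, (n <= k)%N -> err k <= eps >].
  by case: ex_n => n Hn; exists n; apply/asboolP.
case: (ex_minnP ex_n') => K /asboolP HK Kmin.
by exists K; split=> // K' HK'; apply: Kmin; apply/asboolP.
Qed.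

Lemma geometric_eventually_le err C rho eps :
  0 < rho -> rho < 1 -> 0 < C -> (forall k, err k <= C * rho ^+ k) ->
  0 < eps -> exists n, forall k, (n <= k)%N -> err k <= eps.
Proof.
move=> rho_gt0 rho_lt1 C_gt0 err_le eps_gt0.
have /cvgrPdist_le/(_ (eps / C) (divr_gt0 eps_gt0 C_gt0)) [n _ Hn] :
    rho ^+ k @[k --> \oo] --> (0 : R) by apply: cvg_expr; rewrite gtr0_norm.
exists n => k le_nk; apply: le_trans (err_le k) _.
have := Hn k le_nk; rewrite /= sub0r normrN.
rewrite ger0_norm ?exprn_ge0 ?(ltW rho_gt0)//.
by rewrite ler_pdivlMr// mulrC.
Qed.

(* Minimality of K.+1 gives an error exceeding eps at some k >= K, hence
   eps < C * rho ^+ K; take logarithms. *)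
Lemma iterations_needed_le_ln err C rho eps K :
  0 < rho -> rho < 1 -> 0 < C -> (forall k, err k <= C * rho ^+ k) ->
  0 < eps -> iterations_needed err eps K.+1 ->
  - ln rho * K%:R <= ln C + ln eps^-1.
Proof.
move=> rho_gt0 rho_lt1 C_gt0 err_le eps_gt0 [_ Kmin].
have [k le_Kk lt_err] : exists2 k, (K <= k)%N & eps < err k.
  apply: contrapT => no_k; suff /Kmin : forall k, (K <= k)%N -> err k <= eps.
    by rewrite ltnn.
  by move=> k le_Kk; rewrite leNgt; apply/negP => lt_err; apply: no_k; exists k.
have lt_eps : eps < C * rho ^+ K.
  apply: lt_le_trans lt_err (le_trans (err_le k) _).
  by rewrite ler_pM2l// ler_wiXn2l// ltW.
have : ln eps <= ln (C * rho ^+ K).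
  by rewrite ler_ln ?posrE ?mulr_gt0 ?exprn_gt0// ltW.
rewrite lnM ?posrE ?exprn_gt0// lnXn// lnV ?posrE// -mulr_natr; lra.
Qed.

Lemma iterations_needed_bigO err C rho (K : R -> nat) :
  0 < rho -> rho < 1 -> 0 < C -> (forall k, err k <= C * rho ^+ k) ->
  (forall eps, 0 < eps -> iterations_needed err eps (K eps)) ->
  (fun eps : R => (K eps)%:R : R) =O_ ((0 : R)^'+) (fun eps : R => ln eps^-1).
Proof.
move=> rho_gt0 rho_lt1 C_gt0 err_le HK.
have lnrho_gt0 : 0 < - ln rho by rewrite oppr_gt0 ln_lt0// rho_gt0.
(* For small [eps] both [1] and [ln C] are at most [ln eps^-1]. The summand [1] pays for the
   successor in [K eps = n.+1], and the [2] for [ln C + ln eps^-1], which bounds [- ln rho * n]. *)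
apply/eqO_exP; exists (1 + 2 / - ln rho); first by rewrite addr_gt0 ?divr_gt0.
have /cvgrNyPle lnNy0 := @lnNy R.
near=> eps.
have eps_gt0 : 0 < eps by near: eps; exact: nbhs_right_gt.
have ln_le_N1 : ln eps <= - 1 by near: eps; exact: lnNy0.
have ln_le_NlnC : ln eps <= - ln C by near: eps; exact: lnNy0.
have lnVE : ln eps^-1 = - ln eps by rewrite lnV ?posrE.
have lnV_ge1 : 1 <= ln eps^-1 by rewrite lnVE; lra.
rewrite ger0_norm// (ger0_norm (le_trans ler01 lnV_ge1)).
move: (HK eps eps_gt0); case: (K eps) => [|n] needed.
  by rewrite mulr_ge0 ?addr_ge0 ?divr_ge0 ?ltW// (lt_le_trans ltr01 lnV_ge1).
have := iterations_needed_le_ln rho_gt0 rho_lt1 C_gt0 err_le eps_gt0 needed.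
rewrite -ler_pdivlMl// => le_n.
rewrite -natr1 addrC mulrDl mul1r lerD// (le_trans le_n)//.
rewrite mulrC mulrAC ler_pM2r ?invr_gt0//; lra.
Unshelve. all: by end_near. Qed.

End LinearConvergence.

(** * Coercivity of the blocks and contraction of the weighted energy *)

Section Contraction.
Variables (R : realType) (N d : nat) (lambda1 lambda2 : R).
Variables (A : 'I_N -> 'M[R]_d) (W : 'M[R]_N).
Hypotheses (lambda1_gt0 : 0 < lambda1) (lambda2_gt0 : 0 < lambda2).
Hypothesis A_psd : forall i, psdmx (A i).
Hypothesis W_sym : W \is symmetricmx.
Hypothesis W_ge0 : forall i j, 0 <= W i j.
Implicit Types (Theta : 'M[R]_(d, N)) (b : 'I_N -> 'cV[R]_d) (v : 'cV[R]_d).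

Let B := Bmx lambda1 lambda2 A W.
Let D := degree W.

Let coupling Theta i := (4 * lambda2) *: \sum_j W i j *: col j Theta.

Let sqcol Theta i := \sum_l Theta l i ^+ 2.

Definition energy Theta :=
  \sum_i (lambda1 + lambda2 * D i) * \sum_l Theta l i ^+ 2.

Let lambda1_ge0 : 0 <= lambda1. Proof. exact: ltW. Qed.
Let lambda2_ge0 : 0 <= lambda2. Proof. exact: ltW. Qed.

Lemma W_symE i j : W j i = W i j.
Proof.
have /is_hermitianmxP := W_sym.
by rewrite expr0 scale1r => /matrixP->; rewrite !mxE.
Qed.

Lemma degree_ge0 i : 0 <= D i.
Proof. exact: sumr_ge0. Qed.

Lemma sqcol_ge0 Theta i : 0 <= sqcol Theta i.
Proof. by apply: sumr_ge0 => l _; apply: sqr_ge0. Qed.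

Lemma Bmx_coercive i v :
  (2 * lambda1 + 4 * lambda2 * D i) * \sum_l v l 0 ^+ 2 <=
    (v^T *m (B i *m v)) 0 0.
Proof.
have -> : \sum_l v l 0 ^+ 2 = (v^T *m v) 0 0.
  by rewrite mxE; apply: eq_bigr => l _; rewrite mxE expr2.
rewrite /B /Bmx mulmxDl mulmxDr mul_scalar_mx -scalemxAr mulmxA.
by rewrite [X in _ <= X]mxE [X in _ <= _ + X]mxE lerDr; case: (A_psd i).
Qed.

(** By coercivity a kernel vector has zero squared norm, because the coefficient is positive.
    [det0P] supplies a row vector, hence the transpose. *)
Lemma Bmx_unit i : B i \in unitmx.
Proof.
rewrite unitmxE unitfE; apply/det0P => -[v v_neq0 vB0].
have := Bmx_coercive i v^T; rewrite trmxK mulmxA vB0 mul0mx mxE.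
have c_gt0 : 0 < 2 * lambda1 + 4 * lambda2 * D i.
  by rewrite ltr_wpDr ?mulr_gt0// mulr_ge0 ?mulr_ge0 ?degree_ge0.
rewrite pmulr_rle0// => sum_le0; move/eqP: v_neq0; apply.
apply/rowP => l; rewrite mxE; apply/eqP.
have sum0 : \sum_l v^T l 0 ^+ 2 = 0.
  by apply/eqP; rewrite eq_le sum_le0 sumr_ge0// => ? _; apply: sqr_ge0.
have /psumr_eq0P/(_ sum0 l isT) : forall l, true -> 0 <= v^T l 0 ^+ 2.
  by move=> ? _; apply: sqr_ge0.
by rewrite mxE => /eqP; rewrite sqrf_eq0.
Qed.

Lemma column_contraction Theta Theta' i :
  B i *m col i Theta' = coupling Theta i ->
  (lambda1 + lambda2 * D i) * sqcol Theta' i <=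
    lambda2 * \sum_j W i j * sqcol Theta j.
Proof.
move=> eq_i; have := Bmx_coercive i (col i Theta').
rewrite {}eq_i /coupling.
have -> : \sum_l (col i Theta') l 0 ^+ 2 = sqcol Theta' i.
  by apply: eq_bigr => l _; rewrite mxE.
rewrite -scalemxAr mxE mulmx_sumr summxE.
have -> : \sum_j ((col i Theta')^T *m (W i j *: col j Theta)) 0 0 =
    \sum_j W i j * \sum_l Theta' l i * Theta l j.
  apply: eq_bigr => j _; rewrite -scalemxAr !mxE; congr (_ * _).
  by apply: eq_bigr => l _; rewrite !mxE.
have : 2 * \sum_j W i j * (\sum_l Theta' l i * Theta l j) <=
    D i * sqcol Theta' i + \sum_j W i j * sqcol Theta j.
  (* Reopening [D i] as a sum over [j] reduces the claim to one comparison per entry, with common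
     factor [W i j]. *)
  rewrite mulr_sumr /D /degree mulr_suml -big_split/=; apply: ler_sum => j _.
  rewrite mulrCA -mulrDr ler_wpM2l// mulr_sumr -big_split/=.
  apply: ler_sum => l _; have := sqr_ge0 (Theta' l i - Theta l j).
  by rewrite sqrrB; lra.
set S := \sum_j _; set T := \sum_j _.
move: (D i) (sqcol Theta' i) => Di q HST HB.
(* [HB] bounds the quadratic form by [4 * lambda2 * S], and [HST] bounds this by
   [2 * lambda2 * (Di * q + T)]. The [Di * q] term absorbs half of the degree part on the left;
   dividing by 2 gives the claim. *)
have := ler_wpM2l lambda2_ge0 HST; nra.
Qed.

(* The extra lambda1 in numerator and denominator keeps the factor positive even
   when W = 0, so that its logarithm is meaningful. *)
Definition contraction_factor : R :=
  (lambda1 + lambda2 * \sum_i D i) / (2 * lambda1 + lambda2 * \sum_i D i).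

Lemma total_degree_ge0 : 0 <= lambda2 * \sum_i D i.
Proof. by rewrite mulr_ge0// sumr_ge0// => i _; apply: degree_ge0. Qed.

Lemma contraction_factor_gt0 : 0 < contraction_factor.
Proof.
rewrite /contraction_factor.
move: (lambda2 * _) total_degree_ge0 lambda1_gt0 => s *.
by rewrite divr_gt0//; lra.
Qed.

Lemma contraction_factor_lt1 : contraction_factor < 1.
Proof.
rewrite /contraction_factor.
move: (lambda2 * _) total_degree_ge0 lambda1_gt0 => s *.
by rewrite ltr_pdivrMr; lra.
Qed.

(** The factor is the value of the increasing function [t / (lambda1 + t)] at
    [t = lambda1 + lambda2 * \sum_i D i], and [lambda2 * D i] is at most this [t]. *)
Lemma weight_le i :
  lambda2 * D i <= contraction_factor * (lambda1 + lambda2 * D i).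
Proof.
have : lambda2 * D i <= lambda2 * \sum_i D i.
  rewrite ler_wpM2l// (bigD1 i)//= lerDl sumr_ge0// => j _.
  exact: degree_ge0.
have : 0 <= lambda2 * D i by rewrite mulr_ge0 ?degree_ge0.
rewrite /contraction_factor mulrAC.
move: (lambda2 * D i) (lambda2 * \sum_i D i) total_degree_ge0 lambda1_gt0.
move=> x s *.
by rewrite ler_pdivlMr; nra.
Qed.

(** After the column bounds are summed and the sums exchanged, column [j] carries the weight
    [lambda2 * D j], by symmetry of [W]. Keeping two matrices serves both consecutive errors and,
    with both equal, kernel elements of the stationarity map. *)
Lemma energy_contraction Theta Theta' :
  (forall i, B i *m col i Theta' = coupling Theta i) ->
  energy Theta' <= contraction_factor * energy Theta.
Proof.
move=> eqs; rewrite /energy.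
apply: (@le_trans _ _ (\sum_i lambda2 * \sum_j W i j * sqcol Theta j)).
  by apply: ler_sum => i _; apply: column_contraction.
rewrite -mulr_sumr exchange_big/= !mulr_sumr; apply: ler_sum => j _.
rewrite -mulr_suml !mulrA ler_wpM2r ?sqcol_ge0//.
by under eq_bigr do rewrite -W_symE; apply: weight_le.
Qed.

Lemma energy_ge_frobenius Theta :
  lambda1 * frobenius_norm Theta ^+ 2 <= energy Theta.
Proof.
rewrite sqr_sqrtr; last first.
  by apply: sumr_ge0 => l _; apply: sumr_ge0 => i _; apply: sqr_ge0.
rewrite exchange_big mulr_sumr; apply: ler_sum => i _.
by rewrite ler_wpM2r ?sqcol_ge0// lerDl mulr_ge0 ?degree_ge0.
Qed.

Lemma energy_le0 Theta : energy Theta <= 0 -> Theta = 0.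
Proof.
move=> energy_le0; apply/matrixP => l i; rewrite mxE; apply/eqP.
have := le_trans (energy_ge_frobenius Theta) energy_le0.
have sq_ge0 l' i' : 0 <= Theta l' i' ^+ 2 by apply: sqr_ge0.
have row_ge0 l' : 0 <= \sum_i' Theta l' i' ^+ 2 by apply: sumr_ge0.
rewrite pmulr_rle0// sqr_sqrtr ?sumr_ge0// => frob_le0.
rewrite -sqrf_eq0 eq_le sq_ge0 andbT (le_trans _ frob_le0)//.
rewrite (bigD1 l)//= (bigD1 i)//= -addrA lerDl.
by rewrite addr_ge0 ?sumr_ge0.
Qed.

(** * The optimality system as a linear equation: existence and uniqueness *)

Definition stationarity_map Theta : 'M[R]_(d, N) :=
  \matrix_(l < d, i < N) (B i *m col i Theta - coupling Theta i) l 0.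

Lemma stationarity_map_linear : linear stationarity_map.
Proof.
move=> a X Y; apply/matrixP => l i.
have couplingP : coupling (a *: X + Y) i = a *: coupling X i + coupling Y i.
  rewrite /coupling; move: (4 * lambda2) => c.
  rewrite scalerA (mulrC a) -scalerA -scalerDr [a *: \sum_j _]scaler_sumr.
  rewrite -big_split/=.
  congr (_ *: _); apply: eq_bigr => j _.
  by rewrite linearP scalerDr !scalerA (mulrC a).
rewrite mxE couplingP linearP mulmxDr -scalemxAr opprD addrACA -scalerBr.
by rewrite !mxE.
Qed.

HB.instance Definition _ := GRing.isLinear.Build R 'M[R]_(d, N) 'M[R]_(d, N) _
  stationarity_map stationarity_map_linear.

Lemma stationarity_mapP Theta b :
  stationarity_map Theta = \matrix_(l, i) b i l 0 <->
  forall i, B i *m col i Theta = b i + coupling Theta i.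
Proof.
split=> [/matrixP eqT i|eqT]; last first.
  by apply/matrixP => l i; rewrite [LHS]mxE [RHS]mxE eqT addrK.
apply/eqP; rewrite -subr_eq; apply/eqP/colP => l.
by have := eqT l i; rewrite [LHS]mxE [RHS]mxE.
Qed.

(** A kernel element has energy at most [contraction_factor] times itself; as the factor is below 1,
    the energy is at most 0. *)
Lemma stationarity_map_inj : injective stationarity_map.
Proof.
apply: raddf_inj => Theta Theta0; apply: energy_le0.
have eqs i : B i *m col i Theta = coupling Theta i.
  rewrite -[RHS]add0r; move: i; apply/(stationarity_mapP Theta (fun=> 0)).
  by rewrite Theta0; apply/matrixP => l i; rewrite !mxE.
have := energy_contraction eqs; have := contraction_factor_lt1.
move: (energy Theta) contraction_factor => e r; nra.
Qed.

(** Symmetry turns [W i j + W j i] into [2 * W i j]; the multiples of [col i Theta] then move to the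
    left and complete [A i] to [B i]. *)
Lemma optimality_systemP Theta b :
  optimality_system lambda1 lambda2 A b W Theta <->
  forall i, B i *m col i Theta = b i + coupling Theta i.
Proof.
suff eq_i i : A i *m col i Theta - b i -
    (- ((2 * lambda1) *: col i Theta) - (2 * lambda2) *:
          \sum_(j < N) (W i j + W j i) *: (col i Theta - col j Theta)) =
    B i *m col i Theta - (b i + coupling Theta i).
  split=> eqs i; apply/eqP; rewrite -subr_eq0.
    by rewrite -eq_i eqs subrr.
  by rewrite eq_i eqs subrr.
rewrite /B /Bmx mulmxDl mul_scalar_mx /coupling /degree.
have -> : \sum_(j < N) (W i j + W j i) *: (col i Theta - col j Theta) =
    (2 * D i) *: col i Theta - 2 *: \sum_j W i j *: col j Theta.
  rewrite /D /degree mulr_sumr scaler_suml scaler_sumr -sumrB.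
  by apply: eq_bigr => j _; rewrite W_symE scalerA -scalerBr mulr_natl mulr2n.
rewrite /D /degree; move: (\sum_j W i j *: _) (\sum_j W i j) => u s.
apply/colP => l; rewrite !mxE; move: (\sum_j _) => t. ring.
Qed.

Lemma optimality_system_exists_unique b :
  exists! Theta, optimality_system lambda1 lambda2 A b W Theta.
Proof.
have f_inj : injective (linfun stationarity_map).
  by move=> X Y; rewrite !lfunE; apply: stationarity_map_inj.
(* An injective endomorphism of a finite-dimensional space is surjective, so its inverse is also a
   right inverse. *)
have fK := lker0_lfunVK (introT lker0P f_inj).
exists ((linfun stationarity_map)^-1%VF (\matrix_(l, i) b i l 0)); split.
  apply/optimality_systemP/stationarity_mapP.
  by rewrite -[LHS](lfunE stationarity_map) fK.
move=> Theta /optimality_systemP/stationarity_mapP ET.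
by apply: f_inj; rewrite fK lfunE.
Qed.

(** [Theta_star] is a fixed point of the update; subtracting its equation cancels [b] and leaves the
    homogeneous relation that contracts the energy. *)
Lemma update_error_eq b Theta_star Theta i :
  optimality_system lambda1 lambda2 A b W Theta_star ->
  B i *m col i (update lambda1 lambda2 A b W Theta - Theta_star) =
  coupling (Theta - Theta_star) i.
Proof.
move=> /optimality_systemP/(_ i) star_i; rewrite linearB/= mulmxBr {}star_i.
have -> : col i (update lambda1 lambda2 A b W Theta) =
    invmx (B i) *m (b i + coupling Theta i).
  by apply/colP => l; rewrite !mxE.
rewrite mulKVmx ?Bmx_unit// opprD addrACA subrr add0r.
rewrite /coupling -scalerBr -sumrB.
by congr (_ *: _); apply: eq_bigr => j _; rewrite linearB scalerBr.
Qed.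

Lemma iterate_error_le b Theta_star Theta0 k :
  optimality_system lambda1 lambda2 A b W Theta_star ->
  frobenius_norm (iterate lambda1 lambda2 A b W Theta0 k - Theta_star) ^+ 2 <=
    energy (Theta0 - Theta_star) / lambda1 * contraction_factor ^+ k.
Proof.
move=> star.
pose err n := iterate lambda1 lambda2 A b W Theta0 n - Theta_star.
have energy_le : energy (err k) <= contraction_factor ^+ k * energy (err 0%N).
  elim: k => [|k IHk]; first by rewrite expr0 mul1r.
  rewrite exprS -mulrA.
  apply: (@le_trans _ _ (contraction_factor * energy (err k))).
    by apply: energy_contraction => i; apply: update_error_eq.
  by rewrite ler_wpM2l// ltW// contraction_factor_gt0.
rewrite mulrAC ler_pdivlMr// mulrC (le_trans (energy_ge_frobenius _))//.
by rewrite mulrC.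
Qed.

End Contraction.

Theorem theorem3 (R : realType) (N d : nat) (lambda1 lambda2 : R)
    (A : 'I_N -> 'M[R]_d) (b : 'I_N -> 'cV[R]_d) (W : 'M[R]_N)
    (N_ge1 : (1 <= N)%N) (d_ge1 : (1 <= d)%N)
    (lambda1_gt0 : 0 < lambda1) (lambda2_gt0 : 0 < lambda2)
    (A_psd : forall i : 'I_N, psdmx (A i))
    (W_sym : W \is symmetricmx)
    (W_ge0 : forall i j : 'I_N, 0 <= W i j)
    (W_diag0 : forall i : 'I_N, W i i = 0) :
  (exists! Theta_star : 'M[R]_(d, N),
      optimality_system lambda1 lambda2 A b W Theta_star) /\
  (forall Theta_star : 'M[R]_(d, N),
     optimality_system lambda1 lambda2 A b W Theta_star ->
     forall Theta0 : 'M[R]_(d, N),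
     exists K : R -> nat,
       (forall eps : R, 0 < eps ->
          iterations_needed
            (fun k : nat =>
               frobenius_norm
                 (iterate lambda1 lambda2 A b W Theta0 k - Theta_star) ^+ 2)
            eps (K eps)) /\
       (fun eps : R => (K eps)%:R : R) =O_ ((0 : R)^'+) (fun eps : R => ln eps^-1)).
Proof.
split=> [|Theta_star star Theta0]; first exact: optimality_system_exists_unique.
set err := fun k => frobenius_norm _ ^+ 2.
set rho := contraction_factor lambda1 lambda2 W.
(* The added 1 keeps [C] positive even when [Theta0 = Theta_star]. *)
set C := energy lambda1 lambda2 W (Theta0 - Theta_star) / lambda1 + 1.
have rho_gt0 : 0 < rho by apply: contraction_factor_gt0.
have rho_lt1 : rho < 1 by apply: contraction_factor_lt1.
have C_gt0 : 0 < C.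
  rewrite ltr_wpDl// divr_ge0 ?(ltW lambda1_gt0)//.
  apply: le_trans _ (energy_ge_frobenius lambda1 lambda2_gt0 W_ge0 _).
  by rewrite mulr_ge0 ?sqr_ge0 ?(ltW lambda1_gt0).
have err_le k : err k <= C * rho ^+ k.
  rewrite mulrDl mul1r (le_trans (iterate_error_le lambda1_gt0 lambda2_gt0
    A_psd W_sym W_ge0 _ _ star))//.
  by rewrite lerDl exprn_ge0 ?ltW.
(* With [0 < eps] under the existential, [choice] yields a function on all of [R]; the value at
   other [eps] is arbitrary. *)
have needed eps : exists K, 0 < eps -> iterations_needed err eps K.
  have [eps_gt0|] := pselect (0 < eps); last by exists 0%N.
  have [K HK] := iterations_needed_exists
    (geometric_eventually_le rho_gt0 rho_lt1 C_gt0 err_le eps_gt0).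
  by exists K.
have [K HK] := choice needed.
by exists K; split=> //; apply: iterations_needed_bigO err_le HK.
Qed.
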